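(* Let $f:[a,b]\to\mathbb{R}$ be $(l,L)$-Lipschitzian on $[a,b]$, and let $S=\frac{f(b)-f(a)}{b-a}$. Then for all $h\in[0,1]$ and all $x$ with $a+h\frac{b-a}{2}\le x\le b-h\frac{b-a}{2}$, the following three inequalities hold: $$\left|(b-a)\left\{\left[f(x)-\frac{L+l}{2}\left(x-\frac{a+b}{2}\right)\right](1-h)+\frac{f(a)+f(b)}{2}h\right\}-\int_a^b f(t)\,dt\right|\le \frac12\left[\frac{(b-a)^2}{4}\left[h^2+(h-1)^2\right]+\left(x-\frac{a+b}{2}\right)^2\right](L-l),$$ $$\left|(b-a)\left\{\left[f(x)-l\left(x-\frac{a+b}{2}\right)\right](1-h)+\frac{f(a)+f(b)}{2}h\right\}-\int_a^b f(t)\,dt\right|\le (b-a)\max\left\{h\frac{b-a}{2},\,x-a-h\frac{b-a}{2},\,b-x-h\frac{b-a}{2}\right\}(S-l),$$ and $$\left|(b-a)\left\{\left[f(x)-L\left(x-\frac{a+b}{2}\right)\right](1-h)+\frac{f(a)+f(b)}{2}h\right\}-\int_a^b f(t)\,dt\right|\le (b-a)\max\left\{h\frac{b-a}{2},\,x-a-h\frac{b-a}{2},\,b-x-h\frac{b-a}{2}\right\}(L-S).$$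
   Context: Here $a<b$ are real numbers. A function $f:[a,b]\to\mathbb{R}$ is said to be $(l,L)$-Lipschitzian on $[a,b]$, where $l,L\in\mathbb{R}$ with $l<L$, if $l(x_2-x_1)\le f(x_2)-f(x_1)\le L(x_2-x_1)$ for all $a\le x_1\le x_2\le b$. *)

(* Defs.v *)
From Stdlib Require Import Reals.
From Coquelicot Require Import Coquelicot.
Open Scope R_scope.

(* [f] is total on [R], but only its values on [[a, b]] are constrained. *)
Definition lipschitzian (l L a b : R) (f : R -> R) : Prop :=
  l < L /\
  forall x1 x2 : R, a <= x1 -> x1 <= x2 -> x2 <= b ->
    l * (x2 - x1) <= f x2 - f x1 <= L * (x2 - x1).

(* Main.v *)
(* Cutting [a, b] at p = a + h (b - a) / 2, x and q = b - h (b - a) / 2, the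
   quadrature error equals
     - int_a^p (f - f a) + int_p^x (f x - f) - int_x^q (f - f x) + int_q^b (f b - f).
   Bounding each piece by the slope bounds l, L gives the first inequality.
   For nondecreasing f each piece lies between 0 and its length times the
   increment of f, so the error is at most the largest length times f b - f a;
   this applied to f - l t and L t - f gives the other two. *)

Require Import Defs.
From Stdlib Require Import Reals Lra.
From Coquelicot Require Import Coquelicot.
Open Scope R_scope.

(** The slope bounds control [Rabs (f t - f s)] by a constant times [t - s], so [f] is continuous on
    the interval and therefore integrable. *)
Lemma lipschitzian_ex_RInt (a b l L : R) (f : R -> R) :
  a <= b -> lipschitzian l L a b f -> ex_RInt f a b.
Proof.
intros hab [hlL hf].
(* Continuity is needed on both sides of the endpoints, hence the clamped extension of [f]. *)
set (g := fun t => f (Rmax a (Rmin b t))).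
(* The summand 1 keeps [K] positive, so that [eps / K] can serve as the modulus of continuity. *)
set (K := Rabs l + Rabs L + 1).
assert (hK : 0 < K) by (unfold K; pose proof (Rabs_pos l); pose proof (Rabs_pos L); lra).
assert (hfK : forall s t, a <= s -> s <= t -> t <= b -> Rabs (f t - f s) <= K * (t - s)).
{ intros s t h1 h2 h3; destruct (hf s t h1 h2 h3) as [hl hL].
  pose proof (Rle_abs L); pose proof (Rle_abs (- l)) as h4; rewrite Rabs_Ropp in h4.
  pose proof (Rabs_pos l); pose proof (Rabs_pos L).
  apply Rabs_le; unfold K; split; nra. }
assert (hg : forall s t, s <= t -> Rabs (g t - g s) <= K * (t - s)).
{ intros s t hst; unfold g.
  apply Rle_trans with (K * (Rmax a (Rmin b t) - Rmax a (Rmin b s))).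
  - apply hfK; unfold Rmax, Rmin; repeat destruct Rle_dec; lra.
  - apply Rmult_le_compat_l; [lra|].
    unfold Rmax, Rmin; repeat destruct Rle_dec; lra. }
apply ex_RInt_ext with g.
{ intros t; rewrite Rmin_left, Rmax_right by lra; intros ht; unfold g.
  rewrite Rmin_right, Rmax_right by lra; reflexivity. }
apply (ex_RInt_continuous (V := R_CompleteNormedModule)).
intros z _; apply continuity_pt_filterlim.
intros eps heps; exists (eps / K); split; [apply Rdiv_lt_0_compat; lra|].
intros t [_ ht]; simpl in *; unfold R_dist in *.
assert (hlt : K * Rabs (t - z) < eps).
{ apply (Rmult_lt_compat_l K) in ht; [|lra].
  replace (K * (eps / K)) with eps in ht by (field; lra); exact ht. }
apply Rle_lt_trans with (2 := hlt).
destruct (Rle_dec z t).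
- rewrite (Rabs_pos_eq (t - z)) by lra; apply hg; lra.
- rewrite Rabs_minus_sym, (Rabs_minus_sym t z), (Rabs_pos_eq (z - t)) by lra.
  apply hg; lra.
Qed.

Lemma is_RInt_affine (u v w c m : R) :
  is_RInt (fun t => c + m * (t - w)) u v
    (c * (v - u) + m * ((v - w) ^ 2 - (u - w) ^ 2) / 2).
Proof.
set (F := fun t => c * t + m * (t - w) ^ 2 / 2).
replace (c * (v - u) + m * ((v - w) ^ 2 - (u - w) ^ 2) / 2)
  with (minus (F v) (F u))
  by (unfold F, minus, plus, opp; simpl; field).
apply (is_RInt_derive F).
- intros t _; unfold F; auto_derive; [exact I|field].
- intros t _; apply (ex_derive_continuous (fun s => c + m * (s - w))).
  auto_derive; exact I.
Qed.

(** The anchor [w] will be an end of the piece and [c] the value of [f] there. The slopes [m] and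
    [M] are not ordered: to the left of the anchor [t - w] is negative, and the larger slope gives
    the lower bound. *)
Lemma RInt_affine_bounds (u v w c m M : R) (f : R -> R) :
  u <= v -> ex_RInt f u v ->
  (forall t, u < t < v -> c + m * (t - w) <= f t <= c + M * (t - w)) ->
  c * (v - u) + m * ((v - w) ^ 2 - (u - w) ^ 2) / 2 <= RInt f u v
  <= c * (v - u) + M * ((v - w) ^ 2 - (u - w) ^ 2) / 2.
Proof.
intros huv hi hf; apply (RInt_correct (V := R_CompleteNormedModule)) in hi; split;
  [ refine (is_RInt_le _ _ _ _ _ _ huv (is_RInt_affine _ _ w c m) hi _)
  | refine (is_RInt_le _ _ _ _ _ _ huv hi (is_RInt_affine _ _ w c M) _) ];
  intros t ht; apply hf; exact ht.
Qed.

Lemma RInt_increasing_bounds (u v : R) (g : R -> R) :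
  u <= v -> ex_RInt g u v ->
  (forall s t, u <= s -> s <= t -> t <= v -> g s <= g t) ->
  g u * (v - u) <= RInt g u v <= g v * (v - u).
Proof.
intros huv hi hg; apply (RInt_correct (V := R_CompleteNormedModule)) in hi.
assert (hc : forall c, is_RInt (fun _ => c) u v (c * (v - u))).
{ intros c; rewrite Rmult_comm; apply (is_RInt_const (V := R_NormedModule)). }
split;
  [ refine (is_RInt_le _ _ _ _ _ _ huv (hc (g u)) hi _)
  | refine (is_RInt_le _ _ _ _ _ _ huv hi (hc (g v)) _) ];
  intros t ht; apply hg; lra.
Qed.

Lemma RInt_split4 (a p x q b : R) (f : R -> R) :
  a <= p <= x -> x <= q <= b -> ex_RInt f a b ->
  (ex_RInt f a p /\ ex_RInt f p x /\ ex_RInt f x q /\ ex_RInt f q b) /\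
  RInt f a b = RInt f a p + RInt f p x + RInt f x q + RInt f q b.
Proof.
intros h1 h2 hi.
assert (hax : ex_RInt f a x) by (apply (ex_RInt_Chasles_1 f a x b); [lra|exact hi]).
assert (hxb : ex_RInt f x b) by (apply (ex_RInt_Chasles_2 f a x b); [lra|exact hi]).
assert (hap : ex_RInt f a p) by (apply (ex_RInt_Chasles_1 f a p x); [lra|exact hax]).
assert (hpx : ex_RInt f p x) by (apply (ex_RInt_Chasles_2 f a p x); [lra|exact hax]).
assert (hxq : ex_RInt f x q) by (apply (ex_RInt_Chasles_1 f x q b); [lra|exact hxb]).
assert (hqb : ex_RInt f q b) by (apply (ex_RInt_Chasles_2 f x q b); [lra|exact hxb]).
split; [tauto|].
rewrite <- (RInt_Chasles f a x b hax hxb), <- (RInt_Chasles f a p x hap hpx),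
  <- (RInt_Chasles f x q b hxq hqb).
unfold plus; simpl; ring.
Qed.

Lemma increasing_quadrature_bound (a p x q b M : R) (g : R -> R) :
  a <= p <= x -> x <= q <= b -> ex_RInt g a b ->
  (forall s t, a <= s -> s <= t -> t <= b -> g s <= g t) ->
  p - a <= M -> x - p <= M -> q - x <= M -> b - q <= M ->
  Rabs ((p - a) * g a + (q - p) * g x + (b - q) * g b - RInt g a b)
  <= M * (g b - g a).
Proof.
intros h1 h2 hi hg m1 m2 m3 m4.
destruct (RInt_split4 a p x q b g h1 h2 hi) as [(i1 & i2 & i3 & i4) ->].
assert (j1 : g a * (p - a) <= RInt g a p <= g p * (p - a))
  by (apply RInt_increasing_bounds; [lra|exact i1|intros; apply hg; lra]).
assert (j2 : g p * (x - p) <= RInt g p x <= g x * (x - p))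
  by (apply RInt_increasing_bounds; [lra|exact i2|intros; apply hg; lra]).
assert (j3 : g x * (q - x) <= RInt g x q <= g q * (q - x))
  by (apply RInt_increasing_bounds; [lra|exact i3|intros; apply hg; lra]).
assert (j4 : g q * (b - q) <= RInt g q b <= g b * (b - q))
  by (apply RInt_increasing_bounds; [lra|exact i4|intros; apply hg; lra]).
assert (k1 : g a <= g p) by (apply hg; lra).
assert (k2 : g p <= g x) by (apply hg; lra).
assert (k3 : g x <= g q) by (apply hg; lra).
assert (k4 : g q <= g b) by (apply hg; lra).
assert (n1 : (p - a) * (g p - g a) <= M * (g p - g a)) by (apply Rmult_le_compat_r; lra).
assert (n2 : (x - p) * (g x - g p) <= M * (g x - g p)) by (apply Rmult_le_compat_r; lra).
assert (n3 : (q - x) * (g q - g x) <= M * (g q - g x)) by (apply Rmult_le_compat_r; lra).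
assert (n4 : (b - q) * (g b - g q) <= M * (g b - g q)) by (apply Rmult_le_compat_r; lra).
(* The signs of the pieces alternate: the second and fourth alone can make the error positive, the
   first and third alone negative. These nonnegative terms complete either partial sum to the
   telescoping sum [M * (g b - g a)]. *)
assert (z1 : 0 <= M * (g p - g a)) by (apply Rmult_le_pos; lra).
assert (z2 : 0 <= M * (g x - g p)) by (apply Rmult_le_pos; lra).
assert (z3 : 0 <= M * (g q - g x)) by (apply Rmult_le_pos; lra).
assert (z4 : 0 <= M * (g b - g q)) by (apply Rmult_le_pos; lra).
apply Rabs_le; lra.
Qed.

(** On each piece the error lies between [l] and [L] times half the squared length, up to a sign.
    The midpoints of these four ranges add up to the subtracted term, where the signs remain, and
    the half-widths add up to the right-hand side. *)
Lemma lipschitzian_quadrature_bound (a p x q b l L : R) (f : R -> R) :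
  a <= p <= x -> x <= q <= b -> lipschitzian l L a b f ->
  Rabs ((p - a) * f a + (q - p) * f x + (b - q) * f b - RInt f a b
        - (L + l) / 2 * (((x - p) ^ 2 - (q - x) ^ 2 + (b - q) ^ 2 - (p - a) ^ 2) / 2))
  <= (L - l) / 2 * (((p - a) ^ 2 + (x - p) ^ 2 + (q - x) ^ 2 + (b - q) ^ 2) / 2).
Proof.
intros h1 h2 hf.
assert (hi : ex_RInt f a b) by (apply (lipschitzian_ex_RInt a b l L f); [lra|exact hf]).
destruct hf as [_ hf].
destruct (RInt_split4 a p x q b f h1 h2 hi) as [(i1 & i2 & i3 & i4) ->].
assert (j1 := RInt_affine_bounds a p a (f a) l L f (proj1 h1) i1).
(* The anchor is the right end here and in [j4], so [l] and [L] trade places. *)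
assert (j2 := RInt_affine_bounds p x x (f x) L l f (proj2 h1) i2).
assert (j3 := RInt_affine_bounds x q x (f x) l L f (proj1 h2) i3).
assert (j4 := RInt_affine_bounds q b b (f b) L l f (proj2 h2) i4).
destruct j1 as [j1 j1']; [intros t ht; specialize (hf a t); lra|].
destruct j2 as [j2 j2']; [intros t ht; specialize (hf t x); lra|].
destruct j3 as [j3 j3']; [intros t ht; specialize (hf x t); lra|].
destruct j4 as [j4 j4']; [intros t ht; specialize (hf t b); lra|].
apply Rabs_le; lra.
Qed.

Theorem theorem7 (a b l L : R) (f : R -> R)
  (hab : a < b) (hf : lipschitzian l L a b f) :
  let S := (f b - f a) / (b - a) in
  forall h x : R, 0 <= h <= 1 ->
    a + h * ((b - a) / 2) <= x <= b - h * ((b - a) / 2) ->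
    Rabs ((b - a) * ((f x - (L + l) / 2 * (x - (a + b) / 2)) * (1 - h)
                     + (f a + f b) / 2 * h)
          - RInt f a b)
      <= 1 / 2 * ((b - a) ^ 2 / 4 * (h ^ 2 + (h - 1) ^ 2)
                  + (x - (a + b) / 2) ^ 2) * (L - l)
    /\
    Rabs ((b - a) * ((f x - l * (x - (a + b) / 2)) * (1 - h)
                     + (f a + f b) / 2 * h)
          - RInt f a b)
      <= (b - a) * Rmax (h * ((b - a) / 2))
                        (Rmax (x - a - h * ((b - a) / 2))
                              (b - x - h * ((b - a) / 2))) * (S - l)
    /\
    Rabs ((b - a) * ((f x - L * (x - (a + b) / 2)) * (1 - h)
                     + (f a + f b) / 2 * h)
          - RInt f a b)
      <= (b - a) * Rmax (h * ((b - a) / 2))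
                        (Rmax (x - a - h * ((b - a) / 2))
                              (b - x - h * ((b - a) / 2))) * (L - S).
Proof.
intros S h x hh hx.
assert (hi : ex_RInt f a b) by (apply (lipschitzian_ex_RInt a b l L f); [lra|exact hf]).
set (p := a + h * ((b - a) / 2)) in *.
set (q := b - h * ((b - a) / 2)) in *.
set (M := Rmax (h * ((b - a) / 2)) _).
assert (hpa : p - a = h * ((b - a) / 2)) by (unfold p; ring).
assert (hbq : b - q = h * ((b - a) / 2)) by (unfold q; ring).
assert (hnn : 0 <= h * ((b - a) / 2)) by (apply Rmult_le_pos; lra).
assert (h1 : a <= p <= x) by lra.
assert (h2 : x <= q <= b) by lra.
assert (m1 : p - a <= M) by (rewrite hpa; apply Rmax_l).
assert (m4 : b - q <= M) by (rewrite hbq; apply Rmax_l).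
assert (m2 : x - p <= M).
{ replace (x - p) with (x - a - h * ((b - a) / 2)) by lra.
  eapply Rle_trans; [|apply Rmax_r]; apply Rmax_l. }
assert (m3 : q - x <= M).
{ replace (q - x) with (b - x - h * ((b - a) / 2)) by lra.
  eapply Rle_trans; [|apply Rmax_r]; apply Rmax_r. }
assert (haff : forall m, is_RInt (fun t => m * t) a b (m * (b ^ 2 - a ^ 2) / 2)).
{ intros m; apply is_RInt_ext with (fun t => 0 + m * (t - 0)).
  { intros t _; change (@eq R (0 + m * (t - 0)) (m * t)); ring. }
  replace (m * (b ^ 2 - a ^ 2) / 2)
    with (0 * (b - a) + m * ((b - 0) ^ 2 - (a - 0) ^ 2) / 2) by field.
  apply is_RInt_affine. }
apply (RInt_correct (V := R_CompleteNormedModule)) in hi.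
repeat split.
- pose proof (lipschitzian_quadrature_bound a p x q b l L f h1 h2 hf) as E.
  (* Since [p - a = b - q], the outer squares cancel in the subtracted term. With [p + q = a + b]
     and [q - p = (b - a) * (1 - h)], what remains is [(L + l) / 2 * (b - a) * (1 - h) * (x - (a +
     b) / 2)]. *)
  match type of E with Rabs ?A <= ?B =>
    match goal with |- Rabs ?C <= ?D =>
      replace C with A by (unfold p, q; field);
      replace D with B by (unfold p, q; field) end end.
  exact E.
- destruct hf as [_ hf].
  assert (hg : is_RInt (fun t => f t - l * t) a b (RInt f a b - l * (b ^ 2 - a ^ 2) / 2))
    by exact (is_RInt_minus _ _ _ _ _ _ hi (haff l)).
  pose proof (increasing_quadrature_bound a p x q b M (fun t => f t - l * t) h1 h2
    (ex_intro _ _ hg)) as E.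
  rewrite (is_RInt_unique _ _ _ _ hg) in E.
  (* The increment of [f t - l * t] over the interval is [(b - a) * (S - l)]. *)
  match goal with |- _ <= ?D =>
    replace D with (M * (f b - l * b - (f a - l * a))) by (unfold S; field; lra) end.
  (* The error of the rule on [l * t] is [l * (b - a) * (1 - h) * (x - (a + b) / 2)], exactly the
     correction in the statement. *)
  match goal with |- Rabs ?C <= _ =>
    replace C with ((p - a) * (f a - l * a) + (q - p) * (f x - l * x)
      + (b - q) * (f b - l * b) - (RInt f a b - l * (b ^ 2 - a ^ 2) / 2))
      by (unfold p, q; field) end.
  apply E; try assumption.
  intros s t hs hst ht; specialize (hf s t hs hst ht); lra.
- destruct hf as [_ hf].
  assert (hg : is_RInt (fun t => L * t - f t) a b (L * (b ^ 2 - a ^ 2) / 2 - RInt f a b))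
    by exact (is_RInt_minus _ _ _ _ _ _ (haff L) hi).
  pose proof (increasing_quadrature_bound a p x q b M (fun t => L * t - f t) h1 h2
    (ex_intro _ _ hg)) as E.
  rewrite (is_RInt_unique _ _ _ _ hg) in E.
  match goal with |- _ <= ?D =>
    replace D with (M * (L * b - f b - (L * a - f a))) by (unfold S; field; lra) end.
  (* In [L * t - f t] the function [f] enters with a minus sign, so the error is the opposite of the
     stated one. *)
  rewrite <- Rabs_Ropp.
  match goal with |- Rabs ?C <= _ =>
    replace C with ((p - a) * (L * a - f a) + (q - p) * (L * x - f x)
      + (b - q) * (L * b - f b) - (L * (b ^ 2 - a ^ 2) / 2 - RInt f a b))
      by (unfold p, q; field) end.
  apply E; try assumption.
  intros s t hs hst ht; specialize (hf s t hs hst ht); lra.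
Qed.
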